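(* For each $n\ge1$ and each sign $\pm$, let $W_n^{\pm}$ be a random variable with $\mathbb{P}(W_n^\pm=k)=\langle B_n,k\rangle^{\pm}/|B_n^{\pm}|$ for $k=0,\dots,n$ (i.e. $W_n^\pm=\mathrm{des}_B(w)$ for $w$ uniform in $B_n^{\pm}$). Then the distribution of $W_n^{\pm}$ is asymptotically normal as $n\to\infty$. Moreover, for $n\ge 2$ its mean is $n/2$, and for $n\ge3$ its variance is $(n+1)/12$.
   Context: $B_n$ is the group of bijections $w$ of $\{-n,\dots,n\}$ with $w(-i)=-w(i)$, written $w=w(1)\cdots w(n)$, $w(0)=0$. $\mathrm{des}_B(w)=|\{0\le i\le n-1:w(i)>w(i+1)\}|$. Writing $w=u^J$ ($u\in S_n$, $J\subseteq[n]$, $w(j)=-u(j)$ exactly for $j\in J$, otherwise $w(j)=u(j)$), $\mathrm{sgn}_B(w)=(-1)^{|J|}\mathrm{sgn}(u)$. $B_n^\pm=\{w:\mathrm{sgn}_B(w)=\pm1\}$ and $\langle B_n,k\rangle^{\pm}=|\{w\in B_n^{\pm}:\mathrm{des}_B(w)=k\}|$. *)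

(* Defs.v *)
From HB Require Import structures.
From mathcomp Require Import all_boot all_order all_algebra all_fingroup.
From mathcomp Require Import all_classical all_reals all_analysis.
From mathcomp Require Import measurable_realfun.
From mathcomp Require Import zify.

Set Implicit Arguments.
Unset Strict Implicit.
Unset Printing Implicit Defensive.

Import Order.TTheory GRing.Theory Num.Theory.
Import numFieldNormedType.Exports.

Local Open Scope ring_scope.

Section SignedPermutations.
Variable n : nat.

(* The set {-n, ..., n} is encoded as 'I_(2n+1), the ordinal i standing for
   the integer i - n; negation is then rev_ord. *)
Definition zval (i : 'I_n.*2.+1) : int := i%:Z - n%:Z.

Lemma zval_rev_ord i : zval (rev_ord i) = - zval i.
Proof. by rewrite /zval /=; have := ltn_ord i; lia. Qed.

Lemma zval_inj : injective zval.
Proof. by move=> i j ij; apply/val_inj; move: ij; rewrite /zval /=; lia. Qed.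

Definition B_set : {set {perm 'I_n.*2.+1}} :=
  [set w : {perm 'I_n.*2.+1} | [forall i, w (rev_ord i) == rev_ord (w i)]].

Lemma B_group_set : group_set B_set.
Proof.
apply/group_setP; split=> [|v w].
  by rewrite inE; apply/forallP => i; rewrite !perm1.
rewrite !inE => /forallP vB /forallP wB; apply/forallP => i.
by rewrite !permM (eqP (vB i)) (eqP (wB _)).
Qed.

Canonical B_group := Group B_group_set.

Definition signed_perm := subg_of B_group.

(* The integer w(k), for a natural number 0 <= k <= n. *)
Definition sp_val (w : signed_perm) (k : nat) : int :=
  zval (sgval w (inord (n + k))).

Lemma sp_valN (w : signed_perm) (i : 'I_n.*2.+1) :
  zval (sgval w (rev_ord i)) = - zval (sgval w i).
Proof.
have := subgP w; rewrite inE => /forallP /(_ i) /eqP ->.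
exact: zval_rev_ord.
Qed.

Lemma zval_inord k : (k <= n)%N -> zval (inord (n + k)) = k%:Z.
Proof. by move=> kn; rewrite /zval inordK; lia. Qed.

Lemma sp_val0 (w : signed_perm) : sp_val w 0 = 0.
Proof.
rewrite /sp_val; have -> : inord (n + 0) = rev_ord (inord (n + 0)) :> 'I_n.*2.+1.
  by apply/zval_inj; rewrite zval_rev_ord zval_inord.
have := sp_valN w (inord (n + 0)); set i := inord _.
have <- : i = rev_ord i by apply/zval_inj; rewrite zval_rev_ord zval_inord.
by lia.
Qed.

Lemma sp_val_abs_inj (w : signed_perm) j k : (j <= n)%N -> (k <= n)%N ->
  `|sp_val w j|%N = `|sp_val w k|%N -> j = k.
Proof.
move=> jn kn jk.
have [] : sp_val w j = sp_val w k \/ sp_val w j = - sp_val w k by lia.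
  rewrite /sp_val => /zval_inj /perm_inj /(congr1 zval).
  by rewrite !zval_inord //; lia.
rewrite /sp_val -sp_valN => /zval_inj /perm_inj /(congr1 zval).
by rewrite zval_rev_ord !zval_inord //; lia.
Qed.

Lemma sp_val_abs_bound (w : signed_perm) (j : 'I_n) :
  (0 < `|sp_val w j.+1| <= n)%N.
Proof.
apply/andP; split; last first.
  rewrite /sp_val /zval; set i := (X in nat_of_ord X).
  by have := ltn_ord i; lia.
rewrite lt0n; apply/eqP => w0.
suff : j.+1 = 0%N by [].
by apply: (@sp_val_abs_inj w) => //; rewrite ?sp_val0.
Qed.

Lemma sp_abs_subproof (w : signed_perm) (j : 'I_n) :
  (`|sp_val w j.+1|.-1 < n)%N.
Proof. by have := sp_val_abs_bound w j; lia. Qed.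

Definition sp_abs_fun (w : signed_perm) (j : 'I_n) : 'I_n :=
  Ordinal (sp_abs_subproof w j).

Lemma sp_abs_fun_inj w : injective (sp_abs_fun w).
Proof.
move=> j k /(congr1 val) /= jk; apply/val_inj.
suff [] : j.+1 = k.+1 by [].
apply: (@sp_val_abs_inj w) => //.
by have := sp_val_abs_bound w j; have := sp_val_abs_bound w k; lia.
Qed.

(* The decomposition w = u^J, with [n] encoded as 'I_n (j standing for j+1):
   sp_abs w is u and sp_neg w is J. *)
Definition sp_abs (w : signed_perm) : 'S_n := perm (@sp_abs_fun_inj w).

Definition sp_neg (w : signed_perm) : {set 'I_n} :=
  [set j : 'I_n | sp_val w j.+1 < 0].

Lemma sp_decomposition (w : signed_perm) (j : 'I_n) :
  sp_val w j.+1 =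
  if j \in sp_neg w then - (sp_abs w j).+1%:Z else (sp_abs w j).+1%:Z.
Proof.
by rewrite inE permE /=; have := sp_val_abs_bound w j; case: ifP; lia.
Qed.

Definition sgnB (w : signed_perm) : int :=
  (-1) ^+ #|sp_neg w| * (-1) ^+ (sp_abs w : bool).

Definition desB (w : signed_perm) : nat :=
  #|[set i : 'I_n | sp_val w i > sp_val w i.+1]|.

(* The sign s : bool stands for (-1) ^+ s, i.e. false is + and true is -. *)
Definition B_sgn (s : bool) : {set signed_perm} :=
  [set w | sgnB w == (-1) ^+ s].

Definition eulerianB_sgn (k : nat) (s : bool) : nat :=
  #|[set w in B_sgn s | desB w == k]|.

End SignedPermutations.

Local Open Scope classical_set_scope.

Section AsymptoticNormality.
Context (R : realType).

Section Standardize.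
Context d (T : measurableType d) (P : probability T R) (X : {RV P >-> R}).

(* If the variance is 0 this is the constant 0. *)
Definition standardize_fun (t : T) : R :=
  (X t - fine 'E_P[X]) / Num.sqrt (fine 'V_P[X]).

Lemma measurable_standardize : measurable_fun [set: T] standardize_fun.
Proof. by apply: measurable_funM => //; exact: measurable_funB. Qed.

HB.instance Definition _ :=
  isMeasurableFun.Build _ _ _ _ standardize_fun measurable_standardize.

Definition standardize : {RV P >-> R} := standardize_fun.

End Standardize.

(* Convergence in distribution of the standardized variables to N(0, 1). *)
Definition asymptotically_normal (d : nat -> measure_display)
    (T : forall n, measurableType (d n)) (P : forall n, probability (T n) R)
    (W : forall n, {RV (P n) >-> R}) : Prop :=
  forall x : R,
    cdf (standardize (W n)) x @[n --> \oo] --> normal_prob 0 1 `]-oo, x].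

End AsymptoticNormality.

(* Main.v *)
(** Inserting the letter [n.+1] or [- n.+1] into a signed permutation of [n]
    with [k] descents keeps [k] in [2k+1] cases and raises it by one in
    [2(n-k)+1] cases; away from the last position the two letters give the same
    number of descents and opposite signs. Hence the signed sum
    [sum sgn(w) h(des w)] over [B_n] is the [n]-fold difference of [h] at [0]: it
    vanishes on polynomials of degree [< n] and is at most [2^n sup |h|], which
    is negligible against [|B_n| = 2^n n!]. So mean, variance and limit law
    of [W_n^+] and [W_n^-] are those of [des_B] on all of [B_n].

    On [B_n], the recursion makes [n (des_B - n/2)] a martingale whose increment
    at step [j] takes two values [j] apart and has conditional variance
    [j^2/4 - y^2], where [y = des_B - (j-1)/2] before the step. Lindeberg's
    replacement argument is run with the explicit solution
    [heat v b = P (sqrt v * Z <= b)] of the heat equation as test function, so no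
    Gaussian convolution is needed; the initial variance [e > 0] smooths the
    indicator function and tends to [0] at the end. *)
From HB Require Import structures.
From mathcomp Require Import all_boot all_order all_algebra all_fingroup.
From mathcomp Require Import all_classical all_reals all_analysis.
From mathcomp Require Import measurable_realfun.
From mathcomp Require Import zify ring lra.
Require Import Defs.

Set Implicit Arguments.
Unset Strict Implicit.
Unset Printing Implicit Defensive.

Import Order.TTheory GRing.Theory Num.Theory.
Import numFieldNormedType.Exports.

Local Open Scope ring_scope.

(** * The Gaussian distribution function and the heat equation *)

Section Gaussian.
Local Open Scope classical_set_scope.
Local Open Scope ring_scope.
Context {R : realType}.
Implicit Types x z v b h : R.

Definition gauss_pdf x : R := normal_pdf 0 1 x.
Definition gauss_cdf x : R := fine (normal_prob 0 1 `]-oo, x]).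

Lemma gauss_pdfE x :
  gauss_pdf x = normal_peak 1 * expR (- (2^-1 * (x * x))).
Proof.
rewrite /gauss_pdf normal_pdfE ?oner_eq0// /normal_fun.
by congr (_ * expR _); rewrite subr0 expr1n -mulr_natr; field.
Qed.

Lemma gauss_pdf_ge0 x : 0 <= gauss_pdf x.
Proof. exact: normal_pdf_ge0. Qed.

Lemma is_derive_gauss_pdf x : is_derive x 1 gauss_pdf (- x * gauss_pdf x).
Proof.
have -> : gauss_pdf = fun y => normal_peak 1 * expR (- (2^-1 * (y * y))).
  by apply/funext => y; rewrite gauss_pdfE.
by apply: is_derive_eq; rewrite /= /GRing.scale /=; field.
Qed.

Lemma is_derive_gauss_cdf x : is_derive x 1 gauss_cdf (gauss_pdf x).
Proof.
have h0 : (x < x + 1) by rewrite ltrDl.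
have int1 : lebesgue_measure.-integrable
    [set` Interval -oo%O (BRight (x + 1))] (EFin \o (@normal_pdf R 0 1)).
  apply: (integrableS measurableT) => //.
  by apply: integrable_normal_pdf; rewrite oner_eq0.
have c1 : {for x, continuous (@normal_pdf R 0 1)}.
  by apply: continuous_normal_pdf; rewrite oner_eq0.
have [] := @continuous_FTC1 R (@normal_pdf R 0 1) -oo%O x (x + 1) h0 int1 (ltNyr x) c1.
by move=> /= D E; split; [exact: D | rewrite -derive1E; exact: E].
Qed.

Lemma gauss_cdf_ge0 x : 0 <= gauss_cdf x.
Proof. exact: fine_ge0. Qed.

Lemma gauss_cdf_EFin x : (gauss_cdf x)%:E = normal_prob 0 1 `]-oo, x].
Proof. by rewrite /gauss_cdf fineK// fin_num_measure. Qed.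

Lemma gauss_cdf_le1 x : gauss_cdf x <= 1.
Proof. by rewrite -lee_fin gauss_cdf_EFin probability_le1. Qed.

Lemma gauss_cdf_nondecreasing : {homo gauss_cdf : x y / x <= y}.
Proof.
move=> x y xy; rewrite -lee_fin !gauss_cdf_EFin le_measure ?inE//.
exact: subitvPr.
Qed.

Lemma gauss_cdf_continuous : continuous gauss_cdf.
Proof.
move=> x; apply: differentiable_continuous; apply/derivable1_diffP.
exact: (@ex_derive _ _ _ _ _ _ _ (is_derive_gauss_cdf x)).
Qed.

Let idR : measurableTypeR R -> R := idfun.

#[local] HB.instance Definition _ :=
  @isMeasurableFun.Build _ _ _ _ idR (@measurable_id _ _ setT).

(** The identity is a random variable under the Gaussian law and [gauss_cdf] is its [cdf], so the
    limits of a [cdf] at both infinities apply. *)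
Lemma gauss_cdf_tails (e : R) : 0 < e ->
  exists2 M, 0 < M & (gauss_cdf (- M) <= e) && (1 - e <= gauss_cdf M).
Proof.
move=> e0; pose X : {RV (@normal_prob R 0 1) >-> R} := idR.
have up : gauss_cdf x @[x --> +oo] --> (1 : R).
  by have /fine_cvgP[_] := cvg_cdfy1 X.
have dn : gauss_cdf x @[x --> -oo] --> (0 : R).
  by have /fine_cvgP[_] := cvg_cdfNy0 X.
have /cvgrPdist_le/(_ _ e0)[A [_ HA]] := up.
have /cvgrPdist_le/(_ _ e0)[B [_ HB]] := dn.
pose M := `|A| + `|B| + 1.
exists M; first by rewrite /M; have := normr_ge0 A; have := normr_ge0 B; lra.
have /HA : A < M by rewrite /M; have := normr_ge0 B; have := ler_norm A; lra.
have /HB : - M < B.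
  by rewrite /M; have := normr_ge0 A; have := ler_norm (- B); rewrite normrN; lra.
rewrite !ler_norml => /andP[h1 h2] /andP[h3 h4].
by apply/andP; split; lra.
Qed.

(** With [u = 1 + z^2/4], the inequality [u <= exp (z^2/4)] squares to [u^2 exp (- z^2/2) <= 1]. The
    constant 8 is a common choice that covers the polynomial factors of [heat_bb], [heat_bbb] and
    [heat_vv]. *)
Lemma gauss_pdf_poly_bound z p : `|p| <= 8 * (1 + z ^+ 2 / 4) ^+ 2 ->
  `|p * gauss_pdf z| <= 8 * normal_peak 1.
Proof.
move=> hp; rewrite normrM (ger0_norm (gauss_pdf_ge0 z)) gauss_pdfE.
set k := normal_peak 1; have k0 : 0 <= k by exact: normal_peak_ge0.
set u := 1 + z ^+ 2 / 4 in hp.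
have u0 : 0 < u by rewrite /u; have := sqr_ge0 z; lra.
have hu : u * expR (- (z ^+ 2 / 4)) <= 1.
  rewrite expRN ler_pdivrMr ?expR_gt0// mul1r.
  exact: expR_ge1Dx.
have -> : - (2^-1 * (z * z)) = - (z ^+ 2 / 4) + - (z ^+ 2 / 4) by field.
rewrite expRD; set E := expR _ in hu *.
have E0 : 0 <= E by exact: expR_ge0.
have uE0 : 0 <= u * E by rewrite mulr_ge0// ltW.
have uE1 : (u * E) ^+ 2 <= 1 by rewrite exprn_ile1.
rewrite (_ : `|p| * (k * (E * E)) = (`|p| * E ^+ 2) * k); last by ring.
apply: ler_wpM2r => //.
apply: (@le_trans _ _ (8 * u ^+ 2 * E ^+ 2)).
  by apply: ler_wpM2r => //; exact: sqr_ge0.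
by rewrite -mulrA -exprMn; lra.
Qed.

(* [heat v b = P (sqrt v * Z <= b)] for [Z] standard Gaussian. *)
Definition heat v b := gauss_cdf (b / Num.sqrt v).
Definition heat_b v b := gauss_pdf (b / Num.sqrt v) / Num.sqrt v.
Definition heat_bb v b :=
  - (b / Num.sqrt v) * gauss_pdf (b / Num.sqrt v) / v.
Definition heat_bbb v b :=
  ((b / Num.sqrt v) ^+ 2 - 1) * gauss_pdf (b / Num.sqrt v) / (v * Num.sqrt v).
Definition heat_vv v b :=
  (b / Num.sqrt v * (3 - (b / Num.sqrt v) ^+ 2) / 4) *
  gauss_pdf (b / Num.sqrt v) / v ^+ 2.

Let scaleE (a b : R) : a *: (b : R^o) = a * b.
Proof. by []. Qed.

(** Writes [v] and its root as powers of one nonzero [s], so that [field] can check identities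
    mixing both. *)
Let sqrt_witness v : 0 < v ->
  exists s : R, [/\ s != 0, Num.sqrt v = s & v = s ^+ 2].
Proof.
move=> v0; exists (Num.sqrt v); split=> //; first by rewrite gt_eqF// sqrtr_gt0.
by rewrite sqr_sqrtr// ltW.
Qed.

Let is_derive_scaled v b :
  is_derive b 1 (fun b => b / Num.sqrt v) (Num.sqrt v)^-1.
Proof. by apply: is_derive_eq; rewrite !scaleE /=; ring. Qed.

Let is_derive_scaling v b : 0 < v ->
  is_derive v 1 (fun v => b / Num.sqrt v) (- (b / Num.sqrt v) / (2 * v)).
Proof.
move=> v0; have s0 : Num.sqrt v != 0 by rewrite gt_eqF// sqrtr_gt0.
have D := is_deriveV s0 (is_derive1_sqrt v0).
apply: (is_derive_eq (is_deriveM (is_derive_cst _ _ _) D)).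
rewrite !scaleE /=.
by have [s [sn0 -> ->]] := sqrt_witness v0; field.
Qed.

Lemma is_derive_heat_b v b : is_derive b 1 (heat v) (heat_b v b).
Proof.
exact: (@is_derive1_comp _ gauss_cdf (fun b => b / Num.sqrt v) _ _ _
  (is_derive_gauss_cdf _) (is_derive_scaled v b)).
Qed.

Lemma is_derive_heat_bb v b : 0 < v -> is_derive b 1 (heat_b v) (heat_bb v b).
Proof.
move=> v0; have s0 : Num.sqrt v != 0 by rewrite gt_eqF// sqrtr_gt0.
have D := @is_derive1_comp _ gauss_pdf (fun b => b / Num.sqrt v) b _ _
  (is_derive_gauss_pdf _) (is_derive_scaled v b).
apply: (is_derive_eq (is_deriveM D (is_derive_cst (Num.sqrt v)^-1 _ _))).
rewrite /heat_bb !scaleE /=.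
by have [s [sn0 -> ->]] := sqrt_witness v0; field.
Qed.

Lemma is_derive_heat_bbb v b : 0 < v ->
  is_derive b 1 (heat_bb v) (heat_bbb v b).
Proof.
move=> v0; have s0 : Num.sqrt v != 0 by rewrite gt_eqF// sqrtr_gt0.
have D := @is_derive1_comp _ gauss_pdf (fun b => b / Num.sqrt v) b _ _
  (is_derive_gauss_pdf _) (is_derive_scaled v b).
apply: (is_derive_eq (is_deriveM
  (is_deriveM (is_deriveN (is_derive_scaled v b)) D) (is_derive_cst v^-1 _ _))).
rewrite /heat_bbb !scaleE !fctE /=.
by have [s [sn0 -> ->]] := sqrt_witness v0; field.
Qed.

(** This is the heat equation; it is why there is no separate [heat_v]. *)
Lemma is_derive_heat_v v b : 0 < v ->
  is_derive v 1 (heat ^~ b) (heat_bb v b / 2).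
Proof.
move=> v0.
have D := @is_derive1_comp _ gauss_cdf (fun v => b / Num.sqrt v) v _ _
  (is_derive_gauss_cdf _) (is_derive_scaling b v0).
apply: (is_derive_eq D).
rewrite /heat_bb /=; field.
by rewrite !gt_eqF ?sqrtr_gt0.
Qed.

Lemma is_derive_heat_vv v b : 0 < v ->
  is_derive v 1 (fun v => heat_bb v b / 2) (heat_vv v b).
Proof.
move=> v0; have vn0 : v != 0 by rewrite gt_eqF.
have s0 : Num.sqrt v != 0 by rewrite gt_eqF// sqrtr_gt0.
have D := @is_derive1_comp _ gauss_pdf (fun v => b / Num.sqrt v) v _ _
  (is_derive_gauss_pdf _) (is_derive_scaling b v0).
have DV := is_deriveV vn0 (@is_derive_id _ R v 1).
have DD := is_deriveM (is_deriveM
  (is_deriveM (is_deriveN (is_derive_scaling b v0)) D) DV) (is_derive_cst (2^-1 : R) v 1).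
apply: (@is_derive_eq _ _ _ (fun v => heat_bb v b / 2) _ _ _ _ DD).
rewrite /heat_vv !scaleE !fctE /=.
by field; rewrite vn0 s0.
Qed.

(** In this bound and the next two, the Gaussian absorbs the polynomial in [b / sqrt v]; the
    negative power of [v] that remains is largest at [v = e]. *)
Lemma heat_bbb_bound e v b : 0 < e -> e <= v ->
  `|heat_bbb v b| <= 8 * normal_peak 1 / (e * Num.sqrt e).
Proof.
move=> e0 ev; have v0 := lt_le_trans e0 ev.
rewrite /heat_bbb normrM; apply: ler_pM => //.
  apply: gauss_pdf_poly_bound; set z := b / _.
  have := sqr_ge0 z; rewrite ler_norml => ?; apply/andP; split; nra.
rewrite gtr0_norm ?invr_gt0 ?mulr_gt0 ?sqrtr_gt0//.
rewrite lef_pV2 ?posrE ?mulr_gt0 ?sqrtr_gt0//.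
by apply: ler_pM; rewrite ?sqrtr_ge0 ?(ltW e0) ?ler_wsqrtr.
Qed.

Lemma heat_vv_bound e v b : 0 < e -> e <= v ->
  `|heat_vv v b| <= 8 * normal_peak 1 / e ^+ 2.
Proof.
move=> e0 ev; have v0 := lt_le_trans e0 ev.
rewrite /heat_vv normrM; apply: ler_pM => //.
  apply: gauss_pdf_poly_bound; set z := b / _.
  have := sqr_ge0 (z ^+ 2); have := sqr_ge0 (z - 1); have := sqr_ge0 (z + 1).
  have := sqr_ge0 z; have := sqr_ge0 (z * (z - 1)); have := sqr_ge0 (z * (z + 1)).
  rewrite ler_norml => ? ? ? ? ? ?; apply/andP; split; nra.
rewrite ger0_norm ?invr_ge0 ?sqr_ge0//.
rewrite lef_pV2 ?posrE ?exprn_gt0//.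
by rewrite ler_pXn2r ?nnegrE ?(ltW e0) ?(ltW v0).
Qed.

Lemma heat_bb_bound e v b : 0 < e -> e <= v ->
  `|heat_bb v b| <= 8 * normal_peak 1 / e.
Proof.
move=> e0 ev; have v0 := lt_le_trans e0 ev.
rewrite /heat_bb normrM; apply: ler_pM => //.
  apply: gauss_pdf_poly_bound; set z := b / _.
  have := sqr_ge0 (z - 1); have := sqr_ge0 (z + 1).
  have := sqr_ge0 (z ^+ 2).
  rewrite ler_norml => ? ? ?; apply/andP; split; nra.
rewrite gtr0_norm ?invr_gt0//.
by rewrite lef_pV2 ?posrE.
Qed.

End Gaussian.

(** * Taylor estimates and the one-step replacement bound *)

Section Taylor.
Local Open Scope classical_set_scope.
Local Open Scope ring_scope.
Context {R : realType}.
Implicit Types (f : R -> R) (a b h K e v t p d : R).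

Let is_derive_linear c (x : R) : is_derive x 1 (fun y : R => c * y) c.
Proof.
apply: (is_derive_eq (is_deriveZ c (is_derive_id x 1))).
by rewrite /GRing.scale /= mulr1.
Qed.

Let is_derive_quadratic c (x : R) :
  is_derive x 1 (fun y : R => c * (y * y) / 2) (c * x).
Proof. by apply: is_derive_eq; rewrite /GRing.scale /=; field. Qed.

(** Mean value inequality, with [Num.min] and [Num.max] so that the increment may have either
    sign. *)
Lemma derive_bound_lipschitz f df K a b :
  (forall x, Num.min a b <= x <= Num.max a b -> is_derive x 1 f (df x)) ->
  (forall x, Num.min a b <= x <= Num.max a b -> `|df x| <= K) ->
  `|f b - f a| <= K * `|b - a|.
Proof.
wlog ab : a b / a <= b.
  move=> W; case/orP: (le_total a b) => [/W//|ba D L].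
  rewrite distrC (distrC b); apply: W => // x; rewrite minC maxC.
    exact: D.
  exact: L.
rewrite min_l// max_r// => D L.
have [||c] := @MVT_segment R f df a b ab.
- by move=> x; rewrite in_itv /= => /andP[ax xb]; apply: D; rewrite !ltW.
- apply: derivable_within_continuous => x; rewrite in_itv /= => /D.
  by case.
by rewrite in_itv /= => /L Lc ->; rewrite normrM ler_wpM2r.
Qed.

(** The mean value inequality is applied to [f2], then to [f1] and [f] minus their Taylor
    polynomials; each round costs a factor [|h|]. Hence the constant [K] instead of the sharp
    [K / 6]. *)
Lemma taylor2_bound f f1 f2 f3 K a h :
  (forall x : R, is_derive x 1 f (f1 x)) -> (forall x : R, is_derive x 1 f1 (f2 x)) ->
  (forall x : R, is_derive x 1 f2 (f3 x)) -> (forall x, `|f3 x| <= K) ->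
  `|f (a + h) - f a - f1 a * h - f2 a * h ^+ 2 / 2| <= K * `|h| ^+ 3.
Proof.
move=> D1 D2 D3 L.
have seg x : Num.min 0 h <= x <= Num.max 0 h -> `|x| <= `|h|.
  by case: (leP 0 h) => h0 /andP[x1 x2]; rewrite !ler_norml;
    have := ler_norm h; have := ler_norm (- h); rewrite normrN; lra.
have K0 : 0 <= K by apply: le_trans (L 0).
have B2 x : `|x| <= `|h| -> `|f2 (a + x) - f2 a| <= K * `|h|.
  move=> xh; apply: (@le_trans _ _ (K * `|x|)); last exact: ler_wpM2l.
  have := @derive_bound_lipschitz f2 f3 K a (a + x).
  by rewrite addrAC subrr add0r; apply=> *; auto.
have shift (g g' : R -> R) (x : R) : (forall y : R, is_derive y 1 g (g' y)) ->
    is_derive x 1 (fun x : R => g (a + x)) (g' (a + x)).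
  move=> D; have Dx : is_derive x 1 (fun x : R => a + x) 1.
    apply: (is_derive_eq (is_deriveD (is_derive_cst a x 1) (is_derive_id x 1))).
    by rewrite add0r.
  by have := @is_derive1_comp _ g (fun x : R => a + x) x _ _ (D _) Dx; rewrite mulr1.
have B1 x : `|x| <= `|h| -> `|f1 (a + x) - f1 a - f2 a * x| <= K * `|h| ^+ 2.
  move=> xh; rewrite expr2 mulrA.
  pose g x := f1 (a + x) - f2 a * x.
  have := @derive_bound_lipschitz g (fun x => f2 (a + x) - f2 a) (K * `|h|) 0 x.
  rewrite /g addr0 mulr0 !subr0 addrAC => H.
  apply: le_trans (H _ _) _.
  - by move=> y _; exact: (is_deriveB (shift f1 f2 y D2) (is_derive_linear _ _)).
  - move=> y y0; apply: B2; apply: le_trans xh.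
    by case: (leP 0 x) y0 => x0 /andP[y1 y2]; rewrite !ler_norml;
      have := ler_norm x; have := ler_norm (- x); rewrite normrN; lra.
  - by apply: ler_wpM2l => //; rewrite mulr_ge0.
pose g x := f (a + x) - f1 a * x - f2 a * (x * x) / 2.
have := @derive_bound_lipschitz g
  (fun x => f1 (a + x) - f1 a - f2 a * x) (K * `|h| ^+ 2) 0 h.
have -> : g h - g 0 = f (a + h) - f a - f1 a * h - f2 a * h ^+ 2 / 2.
  by rewrite /g addr0; field.
rewrite subr0 -[K * _ * _]mulrA -exprSr; apply.
- move=> y _; exact: (is_deriveB
    (is_deriveB (shift f f1 y D1) (is_derive_linear _ _)) (is_derive_quadratic _ _)).
- by move=> y /seg; exact: B1.
Qed.

Lemma heat_time_bound e v d b : 0 < e -> e <= v -> 0 <= d ->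
  `|heat (v + d) b - heat v b - heat_bb v b / 2 * d|
    <= 8 * normal_peak 1 / e ^+ 2 * d ^+ 2 :> R.
Proof.
move=> e0 ev d0; have v0 := lt_le_trans e0 ev.
set K := 8 * _ / _.
have K0 : 0 <= K by apply: le_trans (heat_vv_bound b e0 ev).
have B1 x : v <= x <= v + d -> `|heat_bb x b / 2 - heat_bb v b / 2| <= K * d.
  move=> /andP[vx xd].
  have := @derive_bound_lipschitz (fun v => heat_bb v b / 2) (heat_vv ^~ b) K v x.
  rewrite min_l// max_r// => H; apply: le_trans (H _ _) _.
  - move=> y /andP[vy _]; apply: is_derive_heat_vv; exact: lt_le_trans vy.
  - by move=> y /andP[vy _]; apply: heat_vv_bound => //; exact: le_trans vy.
  - by apply: ler_wpM2l => //; rewrite ger0_norm; lra.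
pose g x := heat x b - heat_bb v b / 2 * x.
have vd : v <= v + d by lra.
have := @derive_bound_lipschitz g
  (fun x => heat_bb x b / 2 - heat_bb v b / 2) (K * d) v (v + d).
rewrite min_l// max_r//.
have -> : g (v + d) - g v = heat (v + d) b - heat v b - heat_bb v b / 2 * d.
  by rewrite /g; field.
rewrite [v + d - v]addrAC subrr add0r (ger0_norm d0) -[K * d * d]mulrA -expr2.
apply=> //.
move=> y /andP[vy _]; have D := is_derive_heat_v b (lt_le_trans v0 vy).
exact: (is_deriveB D (is_derive_linear _ _)).
Qed.

(* A centred two-point step of size [t] against a time increment [t ^+ 2 / 4]. *)
Lemma heat_step_bound e v t b p : 0 < e -> e <= v -> 0 <= t -> 0 <= p <= 1 ->
  `|(1 - p) * heat v (b + t * p) + p * heat v (b - t * (1 - p))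
    - heat (v + t ^+ 2 / 4) b|
  <= 8 * normal_peak 1 / (e * Num.sqrt e) * t ^+ 3 +
     8 * normal_peak 1 / e * t ^+ 2 * (2^-1 - p) ^+ 2 +
     8 * normal_peak 1 / e ^+ 2 * t ^+ 4 :> R.
Proof.
move=> e0 ev t0 /andP[p0 p1]; have v0 := lt_le_trans e0 ev.
have T h := taylor2_bound b h (fun x => is_derive_heat_b v x)
  (fun x => is_derive_heat_bb x v0) (fun x => is_derive_heat_bbb x v0)
  (fun x => heat_bbb_bound x e0 ev).
have S : 0 <= t ^+ 2 / 4 by rewrite divr_ge0// sqr_ge0.
have := heat_time_bound b e0 ev S.
have := T (t * p); have := T (- (t * (1 - p))); have := heat_bb_bound b e0 ev.
rewrite !normrN ![`|t * _|]ger0_norm ?mulr_ge0 ?subr_ge0// => {T}.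
set K3 := _ / (e * _); set K2 := _ / e; set K4 := _ / e ^+ 2.
have K30 : 0 <= K3 by apply: le_trans (heat_bbb_bound b e0 ev).
have K40 : 0 <= K4 by apply: le_trans (heat_vv_bound b e0 ev).
set B := heat_bb v b; set B1 := heat_b v b; set B0 := heat v b.
set Hp := heat v (b + t * p); set Hm := heat v (b - t * (1 - p)).
set Hv := heat (v + _) b.
set rp := Hp - B0 - _ - _; set rm := Hm - B0 - _ - _; set rv := Hv - B0 - _.
move=> LB Lm Lp Lv.
(* The first-order terms cancel because the step is centred. Its variance is
   [t^2 p (1 - p) = t^2/4 - t^2 (1/2 - p)^2]; the heat equation matches [t^2/4] with the time
   increment, and the defect is left over. *)
have -> : (1 - p) * Hp + p * Hm - Hv
  = (1 - p) * rp + p * rm - rv - B / 2 * t ^+ 2 * (2^-1 - p) ^+ 2.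
  by rewrite /rp /rm /rv; field.
have q0 : 0 <= 1 - p by lra.
have t30 : 0 <= t ^+ 3 by exact: exprn_ge0.
have t20 : 0 <= t ^+ 2 by exact: exprn_ge0.
have p31 : p ^+ 3 <= 1 by rewrite exprn_ile1.
have q31 : (1 - p) ^+ 3 <= 1 by rewrite exprn_ile1//; lra.
have {}Lp : `|rp| <= K3 * t ^+ 3.
  by apply: le_trans Lp _; rewrite exprMn; apply: ler_wpM2l => //; rewrite ler_piMr.
have {}Lm : `|rm| <= K3 * t ^+ 3.
  by apply: le_trans Lm _; rewrite exprMn; apply: ler_wpM2l => //; rewrite ler_piMr.
have A1 : `|(1 - p) * rp + p * rm| <= K3 * t ^+ 3.
  apply: le_trans (ler_normD _ _) _; rewrite !normrM (ger0_norm q0) (ger0_norm p0).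
  by have := ler_wpM2l q0 Lp; have := ler_wpM2l p0 Lm; lra.
have A2 : `|B / 2 * t ^+ 2 * (2^-1 - p) ^+ 2| <= K2 * t ^+ 2 * (2^-1 - p) ^+ 2.
  rewrite normrM (normrM (B / 2)) (ger0_norm t20) (ger0_norm (sqr_ge0 (_ - p))).
  do 2!(apply: ler_wpM2r; first exact: sqr_ge0).
  apply: le_trans LB; rewrite normrM [X in _ * X]ger0_norm ?invr_ge0//.
  by have := normr_ge0 B; lra.
have A3 : `|rv| <= K4 * t ^+ 4.
  apply: le_trans Lv _; apply: ler_wpM2l => //.
  rewrite exprMn -exprM; have : 0 <= t ^+ 4 by exact: exprn_ge0.
  by set X := t ^+ _; rewrite expr2; lra.
apply: le_trans (ler_normB _ _) _; rewrite [leRHS]addrAC; apply: lerD => //.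
by apply: le_trans (ler_normB _ _) _; apply: lerD.
Qed.

End Taylor.

(** * The unsigned type B Eulerian distribution *)

Section EulerianMean.
Context {R : realType}.
Implicit Types (f g h : nat -> R) (n k : nat) (c e v x a : R).

(* Inserting [n.+1] or [- n.+1] into a signed permutation of [n] with [k]
   descents creates no descent in [2k+1] of the [2(n+1)] cases and exactly one
   otherwise; [eulerB_mean n h] is therefore the mean of [h (desB w)] over
   [B_n]. *)
Definition eulerB_step n h k : R :=
  (k.*2.+1%:R * h k + (n.*2.+1%:R - k.*2%:R) * h k.+1) / n.+1.*2%:R.

Fixpoint eulerB_mean n h : R :=
  if n is m.+1 then eulerB_mean m (eulerB_step m h) else h 0%N.

(** The range [k <= n] is where the weight [2n + 1 - 2k] of [eulerB_step] is nonnegative, and a step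
    from it stays within [n.+1]. *)
Lemma eulerB_mean_le n f g : (forall k, (k <= n)%N -> f k <= g k) ->
  eulerB_mean n f <= eulerB_mean n g.
Proof.
elim: n f g => [|n IH] f g fg /=; first exact: fg.
apply: IH => k kn; rewrite /eulerB_step ler_wpM2r ?invr_ge0//.
apply: lerD; apply: ler_wpM2l => //; try by apply: fg; lia.
by rewrite subr_ge0 ler_nat; lia.
Qed.

Lemma eq_eulerB_mean n f g : (forall k, (k <= n)%N -> f k = g k) ->
  eulerB_mean n f = eulerB_mean n g.
Proof.
move=> fg; apply/eqP; rewrite eq_le.
by rewrite !eulerB_mean_le// => k /fg ->.
Qed.

Lemma eulerB_mean_linear n c f g :
  eulerB_mean n (fun k => c * f k + g k) =
  c * eulerB_mean n f + eulerB_mean n g.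
Proof.
elim: n f g => [|n IH] f g //=; rewrite -IH; apply: eq_eulerB_mean => k _.
by rewrite /eulerB_step; ring.
Qed.

Let natrS n : n.+1%:R = n%:R + 1 :> R.
Proof. by rewrite natr1. Qed.

Let natr_double n : n.*2%:R = 2 * n%:R :> R.
Proof. by rewrite -muln2 natrM mulrC. Qed.

Let natrS_neq0 n : n%:R + 1 != 0 :> R.
Proof. by rewrite natr1 pnatr_eq0. Qed.

Ltac natrS_neq0_tac :=
  rewrite ?natrS_neq0 ?pnatr_eq0 ?[1 + _]addrC ?natrS_neq0 //.

Lemma eulerB_step_cst n c k : eulerB_step n (fun=> c) k = c.
Proof.
rewrite /eulerB_step -mulrDl !(natrS _.*2) !natr_double (natrS n).
by field; natrS_neq0_tac.
Qed.

Lemma eulerB_mean_cst n c : eulerB_mean n (fun=> c) = c.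
Proof.
elim: n => [//|n IH] /=; rewrite -[RHS]IH.
by apply: eq_eulerB_mean => k _; exact: eulerB_step_cst.
Qed.

Lemma eulerB_meanZ n c f :
  eulerB_mean n (fun k => c * f k) = c * eulerB_mean n f.
Proof.
rewrite -[RHS]addr0 -(eulerB_mean_cst n 0) -eulerB_mean_linear.
by apply: eq_eulerB_mean => k _; rewrite addr0.
Qed.

Lemma eulerB_meanD n f g :
  eulerB_mean n (fun k => f k + g k) = eulerB_mean n f + eulerB_mean n g.
Proof.
rewrite -[eulerB_mean n f]mul1r -eulerB_mean_linear.
by apply: eq_eulerB_mean => k _; rewrite mul1r.
Qed.

Lemma eulerB_meanB n f g :
  eulerB_mean n (fun k => f k - g k) = eulerB_mean n f - eulerB_mean n g.
Proof.
rewrite addrC -mulN1r -eulerB_mean_linear.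
by apply: eq_eulerB_mean => k _; ring.
Qed.

Lemma eulerB_mean_norm n f g : (forall k, (k <= n)%N -> `|f k| <= g k) ->
  `|eulerB_mean n f| <= eulerB_mean n g.
Proof.
move=> fg; rewrite ler_norml -mulN1r -eulerB_meanZ; apply/andP; split.
  by apply: eulerB_mean_le => k /fg; rewrite ler_norml mulN1r => /andP[].
by apply: eulerB_mean_le => k /fg; rewrite ler_norml => /andP[].
Qed.

Definition centred n k : R := k%:R - n%:R / 2.

(* Conditionally on [k], a descent is created with probability
   [1/2 - centred n k / n.+1]. *)
Lemma eulerB_stepE n h k (q := centred n k / n.+1%:R) :
  eulerB_step n h k = (2^-1 + q) * h k + (2^-1 - q) * h k.+1.
Proof.
rewrite /eulerB_step /q /centred !(natrS _.*2) !natr_double (natrS n).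
by field; natrS_neq0_tac.
Qed.

Lemma centredS n k : centred n.+1 k = centred n k - 2^-1.
Proof. by rewrite /centred (natrS n); field. Qed.

Lemma centredSS n k : centred n.+1 k.+1 = centred n k + 2^-1.
Proof. by rewrite /centred (natrS n) (natrS k); field. Qed.

(** One insertion multiplies the conditional mean by [1 - 1 / n.+1]: this is the martingale property
    of [n * centred n]. *)
Lemma eulerB_mean_centred n : eulerB_mean n (centred n) = 0.
Proof.
elim: n => [|n IH] /=; first by rewrite /centred mul0r subrr.
transitivity (eulerB_mean n (fun k => (1 - n.+1%:R^-1) * centred n k)).
  apply: eq_eulerB_mean => k _; rewrite eulerB_stepE centredS centredSS.
  by field; natrS_neq0_tac.
by rewrite eulerB_meanZ IH mulr0.
Qed.

Lemma eulerB_mean_sqr_rec n :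
  eulerB_mean n.+1 (fun k => centred n.+1 k ^+ 2) =
  4^-1 + (1 - 2 / n.+1%:R) * eulerB_mean n (fun k => centred n k ^+ 2).
Proof.
rewrite /= addrC -[4^-1](eulerB_mean_cst n) -eulerB_mean_linear.
apply: eq_eulerB_mean => k _; rewrite eulerB_stepE centredS centredSS.
by field; natrS_neq0_tac.
Qed.

(** The induction starts at [n = 2], where the factor [1 - 2/2] removes the earlier value and leaves
    [1/4 = 3/12]; at [n = 1] the value is [1/4], not [2/12]. *)
Lemma eulerB_mean_sqr n : (2 <= n)%N ->
  eulerB_mean n (fun k => centred n k ^+ 2) = n.+1%:R / 12.
Proof.
elim: n => [//|n IH]; rewrite eulerB_mean_sqr_rec leq_eqVlt => /orP[/eqP[<-]|n2].
  by rewrite eulerB_mean_sqr_rec /=; field.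
by rewrite IH// (natrS n.+1); field; natrS_neq0_tac.
Qed.

(** The recursion adds at most [1/4] at each step. This cruder bound also covers [n < 2], as the sum
    over all replacement steps requires. *)
Lemma eulerB_mean_sqr_le n :
  eulerB_mean n (fun k => centred n k ^+ 2) <= n%:R / 4.
Proof.
elim: n => [|n IH]; first by rewrite /= /centred mul0r subrr expr0n mul0r.
rewrite eulerB_mean_sqr_rec mulrBl mul1r [X in _ <= X / _]natrS.
set S := eulerB_mean n _ in IH *.
have S0 : 0 <= S.
  rewrite -[0](eulerB_mean_cst n); apply: eulerB_mean_le => k _.
  exact: sqr_ge0.
have : 0 <= 2 / n.+1%:R * S by rewrite mulr_ge0.
by set X := _ * S; lra.
Qed.

(** The scaled martingale [n * centred n k / c] makes a two-point step of size [t], so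
    [heat_step_bound] applies with [p] the probability of a new descent. As
    [1/2 - p = centred n k / n.+1], the defect [t^2 (1/2 - p)^2] is [centred n k ^ 2 / c^2]. *)
Lemma eulerB_step_heat c e v a n k (t := n.+1%:R / c) :
  0 < c -> 0 < e -> e <= v -> (k <= n)%N ->
  `|eulerB_step n (fun k => heat v (a - n.+1%:R * centred n.+1 k / c)) k -
    heat (v + t ^+ 2 / 4) (a - n%:R * centred n k / c)| <=
  8 * normal_peak 1 / (e * Num.sqrt e) * t ^+ 3 +
  8 * normal_peak 1 / e * (centred n k ^+ 2 / c ^+ 2) +
  8 * normal_peak 1 / e ^+ 2 * t ^+ 4.
Proof.
move=> c0 e0 ev kn; have t0 : 0 <= t by rewrite divr_ge0// ltW.
have n0 : n.+1%:R != 0 :> R by rewrite pnatr_eq0.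
have c1 : c != 0 by rewrite gt_eqF.
pose p := 2^-1 - centred n k / n.+1%:R.
have p01 : 0 <= p <= 1.
  have N0 : 0 < n.+1%:R :> R by rewrite ltr0n.
  have -> : p = (n.+1%:R / 2 - centred n k) / n.+1%:R by rewrite /p; field.
  rewrite divr_ge0 ?ler_pdivrMr//= ?mul1r; rewrite /centred (natrS n);
    have : k%:R <= n%:R :> R by rewrite ler_nat.
    by have : 0 <= k%:R :> R by []; lra.
  lra.
have := heat_step_bound (a - n%:R * centred n k / c) e0 ev t0 p01.
rewrite eulerB_stepE centredS centredSS.
have -> : 2^-1 + centred n k / n.+1%:R = 1 - p by rewrite /p; field.
rewrite -/p.
have -> : a - n%:R * centred n k / c + t * p =
    a - n.+1%:R * (centred n k - 2^-1) / c.
  by rewrite /t /p (natrS n); field; rewrite ?c1 ?andbT; natrS_neq0_tac.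
have -> : a - n%:R * centred n k / c - t * (1 - p) =
    a - n.+1%:R * (centred n k + 2^-1) / c.
  by rewrite /t /p (natrS n); field; rewrite ?c1 ?andbT; natrS_neq0_tac.
rewrite -[8 * _ / e * _ * _]mulrA.
suff -> : t ^+ 2 * (2^-1 - p) ^+ 2 = centred n k ^+ 2 / c ^+ 2 by [].
by rewrite /t /p; field; rewrite ?c1 ?andbT; natrS_neq0_tac.
Qed.

(** The Gaussian variance standing in for the martingale steps [n+1] to [m] that are still to be
    made. *)
Definition clock c n m : R := \sum_(n.+1 <= i < m.+1) (i%:R / c) ^+ 2 / 4.

(** Lindeberg's telescoping, by induction on [n]: each induction step trades one term of the clock
    for one true insertion. The error of a step is bounded uniformly by putting [m] for the step
    number and [m / 4] for the mean square. *)
Lemma eulerB_mean_heat c e a n m : 0 < c -> 0 < e -> (n <= m)%N ->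
  `|eulerB_mean n
      (fun k => heat (e + clock c n m) (a - n%:R * centred n k / c)) -
    heat (e + clock c 0 m) a| <=
  n%:R * (8 * normal_peak 1 / (e * Num.sqrt e) * (m%:R / c) ^+ 3 +
          8 * normal_peak 1 / e * (m%:R / (4 * c ^+ 2)) +
          8 * normal_peak 1 / e ^+ 2 * (m%:R / c) ^+ 4).
Proof.
move=> c0 e0; set K3 := _ / (e * _); set K2 := _ / e; set K4 := _ / e ^+ 2.
have K30 : 0 <= K3 by apply: le_trans (heat_bbb_bound 0 e0 (lexx e)).
have K20 : 0 <= K2 by apply: le_trans (heat_bb_bound 0 e0 (lexx e)).
have K40 : 0 <= K4 by apply: le_trans (heat_vv_bound 0 e0 (lexx e)).
elim: n => [_|n IH nm].
  by rewrite /= !mul0r subr0 subrr normr0.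
have {IH} := IH (ltnW nm).
set rhs := (_ + _ + _).
set A := eulerB_mean n _; set B := heat (e + clock c 0 m) a.
set C := eulerB_mean n.+1 _ => IH.
rewrite (natrS n) mulrDl mul1r (_ : C - B = (A - B) + (C - A)); last by ring.
apply: le_trans (ler_normD _ _) _; apply: lerD => //.
rewrite /C /A /= -eulerB_meanB.
have clockE : clock c n m = clock c n.+1 m + (n.+1%:R / c) ^+ 2 / 4.
  by rewrite /clock big_ltn// addrC.
have cl0 : 0 <= clock c n.+1 m.
  by rewrite /clock sumr_ge0// => i _; rewrite divr_ge0// sqr_ge0.
have ev : e <= e + clock c n.+1 m by lra.
have H k (kn : (k <= n)%N) := eulerB_step_heat a c0 e0 ev kn.
apply: (@le_trans _ _ (eulerB_mean n (fun k => (K2 / c ^+ 2) * centred n k ^+ 2 +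
    (K3 * (n.+1%:R / c) ^+ 3 + K4 * (n.+1%:R / c) ^+ 4)))).
  apply: eulerB_mean_norm => k kn; rewrite clockE [e + (_ + _)]addrA.
  apply: le_trans (H k kn) _; rewrite -/K3 -/K2 -/K4.
  by rewrite le_eqVlt; apply/orP; left; apply/eqP; ring.
rewrite eulerB_mean_linear eulerB_mean_cst /rhs.
have S := eulerB_mean_sqr_le n.
have tm : n.+1%:R / c <= m%:R / c by rewrite ler_wpM2r ?ler_nat// invr_ge0 ltW.
have t0 : 0 <= n.+1%:R / c by rewrite divr_ge0// ltW.
have P3 : K3 * (n.+1%:R / c) ^+ 3 <= K3 * (m%:R / c) ^+ 3.
  by apply: ler_wpM2l => //; rewrite ler_pXn2r// nnegrE (le_trans t0).
have P4 : K4 * (n.+1%:R / c) ^+ 4 <= K4 * (m%:R / c) ^+ 4.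
  by apply: ler_wpM2l => //; rewrite ler_pXn2r// nnegrE (le_trans t0).
suff : K2 / c ^+ 2 * eulerB_mean n (fun k => centred n k ^+ 2) <=
  K2 * (m%:R / (4 * c ^+ 2)) by lra.
have -> : K2 * (m%:R / (4 * c ^+ 2)) = K2 / c ^+ 2 * (m%:R / 4).
  by field; rewrite gt_eqF.
apply: ler_wpM2l; first by rewrite divr_ge0// sqr_ge0.
by apply: le_trans S _; apply: ler_wpM2r => //; rewrite ler_nat ltnW.
Qed.

Lemma clock_total c m : c != 0 ->
  clock c 0 m = m%:R * m.+1%:R * m.*2.+1%:R / (24 * c ^+ 2).
Proof.
move=> c0; rewrite /clock; elim: m => [|m IH].
  by rewrite big_geq// !mul0r.
rewrite big_nat_recr//= {}IH !(natrS _.*2) !natr_double !(natrS m.+1) !(natrS m).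
by field.
Qed.

End EulerianMean.

(** * Central limit theorem for descents on the whole group *)

Section EulerianCLT.
Local Open Scope classical_set_scope.
Local Open Scope ring_scope.
Context {R : realType}.
Implicit Types (e x a s : R) (n k : nat).

Definition std_dev n : R := Num.sqrt (n.+1%:R / 12).

Lemma std_dev_gt0 n : 0 < std_dev n.
Proof. by rewrite sqrtr_gt0 divr_gt0. Qed.

Lemma std_dev_sqr n : std_dev n ^+ 2 = n.+1%:R / 12.
Proof. by rewrite sqr_sqrtr// divr_ge0. Qed.

Lemma cvg_std_devV : (std_dev n)^-1 @[n --> \oo] --> (0 : R).
Proof.
have -> : (fun n => (std_dev n)^-1) = fun n => Num.sqrt (12 * harmonic n).
  by apply/funext => n; rewrite /std_dev -sqrtrV ?divr_ge0// invf_div mulrC.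
rewrite -[X in _ --> X](@sqrtr0 R) -[X in Num.sqrt X](mulr0 (12 : R)).
apply: (@continuous_cvg _ _ _ _ _ _ (Num.sqrt : R -> R)); first exact: sqrt_continuous.
by apply: cvgM; [exact: cvg_cst | exact: cvg_harmonic].
Qed.

(** The replacement bound is used with [m = n] and [c = n * std_dev n], which turns
    [n * centred n k / c] into the standardized variable. The total clock is then [1 + 1 / (2n)],
    and the total error is of order [1 / std_dev n]. *)
Lemma cvg_eulerB_mean_heat e a : 0 < e ->
  eulerB_mean n (fun k => heat e (a - centred n k / std_dev n))
    @[n --> \oo] --> gauss_cdf (a / Num.sqrt (e + 1)).
Proof.
move=> e0; pose E n := eulerB_mean n (fun k => heat e (a - centred n k / std_dev n)).
pose G n := heat (e + (1 + (2 * n%:R)^-1)) a.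
have [K K0 EG] : exists2 K, 0 <= K & forall n, (0 < n)%N ->
    `|E n - G n| <= K * (std_dev n)^-1.
  pose K3 : R := 8 * normal_peak 1 / (e * Num.sqrt e).
  pose K2 : R := 8 * normal_peak 1 / e.
  pose K4 : R := 8 * normal_peak 1 / e ^+ 2.
  have K30 : 0 <= K3 by apply: le_trans (heat_bbb_bound 0 e0 (lexx e)).
  have K20 : 0 <= K2 by apply: le_trans (heat_bb_bound 0 e0 (lexx e)).
  have K40 : 0 <= K4 by apply: le_trans (heat_vv_bound 0 e0 (lexx e)).
  (* With [r] the inverse of [std_dev n], the weights come from [n r^2 <= 12] and [r^2 <= 4 r]. *)
  exists (12 * K3 + 4 * K2 + 48 * K4) => [|n n0]; first by lra.
  have s0 := std_dev_gt0 n; have s2 := std_dev_sqr n.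
  have N0 : 0 < n%:R :> R by rewrite ltr0n.
  have Nn : n%:R != 0 :> R by rewrite gt_eqF.
  have sn : std_dev n != 0 by rewrite gt_eqF.
  have := eulerB_mean_heat a (mulr_gt0 N0 s0) e0 (leqnn n).
  rewrite -/K3 -/K2 -/K4 {1}/clock big_geq// addr0 clock_total ?mulf_neq0//.
  have -> : n%:R * n.+1%:R * n.*2.+1%:R / (24 * (n%:R * std_dev n) ^+ 2) =
      1 + (2 * n%:R)^-1.
    rewrite exprMn s2 -(natr1 n) -(natr1 n.*2) -muln2 natrM.
    by field; rewrite ?Nn ?natr1 ?nat1r ?pnatr_eq0.
  rewrite -/(G n); under eq_eulerB_mean => k _.
    rewrite (_ : n%:R * centred n k / (n%:R * std_dev n) = centred n k / std_dev n).
      over.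
    by field; rewrite ?Nn ?sn.
  rewrite -/(E n) => /le_trans; apply.
  set r := (std_dev n)^-1.
  have r0 : 0 < r by rewrite invr_gt0.
  have r2 : n.+1%:R * r ^+ 2 = 12.
    by rewrite /r exprVn s2; field; rewrite ?natr1 ?nat1r ?pnatr_eq0.
  have nr2 : n%:R * r ^+ 2 <= 12.
    by rewrite -r2 ler_wpM2r ?sqr_ge0// ler_nat.
  have r4 : r <= 4.
    rewrite leNgt; apply/negP => r4; have : 4 ^+ 2 < r ^+ 2 by rewrite ltr_pXn2r// nnegrE ltW.
    have : 1 * r ^+ 2 <= n.+1%:R * r ^+ 2 by rewrite ler_wpM2r ?sqr_ge0// ler1n.
    by rewrite r2; lra.
  have -> : n%:R / (n%:R * std_dev n) = r by rewrite /r; field; rewrite ?Nn ?sn.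
  have -> : n%:R / (4 * (n%:R * std_dev n) ^+ 2) = r ^+ 2 / (4 * n%:R).
    by rewrite /r; field; rewrite ?Nn ?sn.
  have -> : n%:R * (K3 * r ^+ 3 + K2 * (r ^+ 2 / (4 * n%:R)) + K4 * r ^+ 4) =
     K3 * ((n%:R * r ^+ 2) * r) + K2 * (r ^+ 2 / 4) + K4 * ((n%:R * r ^+ 2) * r ^+ 2).
    by field.
  have rr : r ^+ 2 <= 4 * r by rewrite expr2 ler_wpM2r// ltW.
  rewrite [leRHS](_ : _ = K3 * (12 * r) + K2 * (4 * r) + K4 * (48 * r)); last by ring.
  apply: lerD; first apply: lerD.
  - by apply: ler_wpM2l => //; apply: ler_wpM2r => //; rewrite ltW.
  - by apply: ler_wpM2l => //; lra.
  - apply: ler_wpM2l => //.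
    apply: (@le_trans _ _ (12 * r ^+ 2)); last by lra.
    by apply: ler_wpM2r => //; rewrite sqr_ge0.
have cG : G n @[n --> \oo] --> gauss_cdf (a / Num.sqrt (e + 1)).
  apply: (@continuous_cvg _ _ _ _ _ (fun n => e + (1 + (2 * n%:R)^-1)) (heat ^~ a)).
    apply: differentiable_continuous; apply/derivable1_diffP.
    have e1 : 0 < e + 1 by lra.
    by case: (is_derive_heat_v a e1).
  rewrite -[X in _ --> X]addr0 -[X in _ --> X]addrA.
  apply: cvgD; first exact: cvg_cst.
  apply: cvgD; first exact: cvg_cst.
  apply/cvgrPdist_le => d d0; near=> n.
  have n0 : (0 < n)%N by near: n; exact: nbhs_infty_gt.
  rewrite sub0r normrN ger0_norm ?invr_ge0 ?mulr_ge0//.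
  rewrite -[d]invrK lef_pV2 ?posrE ?invr_gt0 ?mulr_gt0 ?ltr0n//.
  have : d^-1 <= n%:R by near: n; exact: nbhs_infty_ger.
  have : 0 <= n%:R :> R by [].
  lra.
have cEG : E n - G n @[n --> \oo] --> 0.
  apply: norm_cvg0; apply: (@squeeze_cvgr _ _ _ _ (fun=> 0)
    (fun n => K * (std_dev n)^-1)).
  - near=> n; rewrite normr_ge0/=; apply: EG.
    by near: n; exact: nbhs_infty_gt.
  - exact: cvg_cst.
  - by rewrite -[X in _ --> X](mulr0 K); apply: cvgM; [exact: cvg_cst|exact: cvg_std_devV].
have -> : (fun n => eulerB_mean n (fun k => heat e (a - centred n k / std_dev n))) =
  (fun n => (E n - G n) + G n) by apply/funext => n; rewrite subrK.
by rewrite -[X in _ --> X]add0r; exact: cvgD.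
Unshelve. all: by end_near. Qed.

(** Up to [d / 3], the indicator lies between two heat functions of variance [s^2] with thresholds
    shifted by [M s] to either side, [M] being chosen from the Gaussian tails. Then [s] is taken so
    small that shift and smoothing move the limit by at most [d / 3]. *)
Lemma cvg_eulerB_mean_cdf x :
  eulerB_mean n (fun k => (centred n k / std_dev n <= x)%R%:R) @[n --> \oo] -->
  gauss_cdf x.
Proof.
apply/cvgrPdist_le => d d0; have d3 : 0 < d / 3 by lra.
have [M M0 /andP[tl tr]] := gauss_cdf_tails d3.
have cont y : gauss_cdf ((x + y * s) / Num.sqrt (s * s + 1)) @[s --> 0^'+] -->
    gauss_cdf x.
  apply: cvg_at_right_filter.
  apply: (@continuous_cvg _ _ _ _ _ _ gauss_cdf); first exact: gauss_cdf_continuous.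
  rewrite [X in _ --> X](_ : x = (x + y * 0) / Num.sqrt (0 * 0 + 1)); last first.
    by rewrite !mulr0 addr0 add0r sqrtr1 divr1.
  apply: cvgM.
    by apply: cvgD; [exact: cvg_cst|apply: cvgM; [exact: cvg_cst|exact: cvg_id]].
  apply: cvgV; first by rewrite mulr0 add0r sqrtr1 oner_eq0.
  apply: (@continuous_cvg _ _ _ _ _ _ (Num.sqrt : R -> R)); first exact: sqrt_continuous.
  by apply: cvgD; [apply: cvgM; exact: cvg_id|exact: cvg_cst].
have [s [s0 sp sm]] : exists s, [/\ 0 < s,
    `|gauss_cdf x - gauss_cdf ((x + M * s) / Num.sqrt (s * s + 1))| <= d / 3 &
    `|gauss_cdf x - gauss_cdf ((x + - M * s) / Num.sqrt (s * s + 1))| <= d / 3].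
  near (0 : R)^'+ => s; exists s; split.
  - by near: s; exact: nbhs_right_gt.
  - by near: s; move/cvgrPdist_le: (cont M); apply.
  - by near: s; move/cvgrPdist_le: (cont (- M)); apply.
have ss0 : 0 < s * s by exact: mulr_gt0.
have sqs : Num.sqrt (s * s) = s by rewrite -expr2 sqrtr_sqr gtr0_norm.
have /cvgrPdist_le/(_ _ d3) Cp := @cvg_eulerB_mean_heat _ (x + M * s) ss0.
have /cvgrPdist_le/(_ _ d3) Cm := @cvg_eulerB_mean_heat _ (x + - M * s) ss0.
have heat01 b : 0 <= heat (s * s) b <= 1.
  by rewrite gauss_cdf_ge0 gauss_cdf_le1.
apply: filterS2 Cp Cm => n Cp Cm.
set I := eulerB_mean n _.
have Ip : I <= eulerB_mean n
    (fun k => heat (s * s) (x + M * s - centred n k / std_dev n)) + d / 3.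
  rewrite -[d / 3](eulerB_mean_cst n) -eulerB_meanD.
  apply: eulerB_mean_le => k _; case: (leP _ x) => [kx|_]; rewrite ?mulr1n ?mulr0n; last first.
    by have /andP[] := heat01 (x + M * s - centred n k / std_dev n); lra.
  suff : gauss_cdf M <= heat (s * s) (x + M * s - centred n k / std_dev n) by lra.
  apply: gauss_cdf_nondecreasing; rewrite sqs ler_pdivlMr//; lra.
have Im : eulerB_mean n
    (fun k => heat (s * s) (x + - M * s - centred n k / std_dev n)) <= I + d / 3.
  rewrite -[d / 3](eulerB_mean_cst n) -eulerB_meanD.
  apply: eulerB_mean_le => k _; case: (leP _ x) => [_|kx]; rewrite ?mulr1n ?mulr0n.
    by have /andP[] := heat01 (x + - M * s - centred n k / std_dev n); lra.
  suff : heat (s * s) (x + - M * s - centred n k / std_dev n) <= gauss_cdf (- M) by lra.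
  apply: gauss_cdf_nondecreasing; rewrite sqs ler_pdivrMr//; lra.
by move: sp sm Cp Cm; rewrite !ler_norml => /andP[? ?] /andP[? ?] /andP[? ?] /andP[? ?];
  apply/andP; split; lra.
Unshelve. all: by end_near. Qed.

End EulerianCLT.

(** * Insertion into signed permutations *)

Section Descents.

(** [x] is the letter preceding the word; [x = 0] gives the descents of type B. *)
Fixpoint descents (x : int) (s : seq int) : nat :=
  if s is y :: s' then ((y < x)%R + descents y s')%N else 0%N.

Lemma descents_cat x s1 s2 :
  descents x (s1 ++ s2) = (descents x s1 + descents (last x s1) s2)%N.
Proof. by elim: s1 x => //= y s1 IH x; rewrite IH addnA. Qed.

Lemma card_descents (f : nat -> int) n :
  #|[set i : 'I_n | f i > f i.+1]| = descents (f 0%N) [seq f i.+1 | i <- iota 0 n].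
Proof.
rewrite -sum1dep_card big_mkcond /=.
elim: n f => [|n IH] f; first by rewrite big_ord0.
rewrite big_ord_recl /= -[1%N]/(1 + 0)%N iotaDl -map_comp -(IH (f \o succn)).
by case: ifP.
Qed.

(** Between two letters, a letter of larger absolute value has exactly one descent beside it, before
    it if negative and after it if positive, whatever comparison stood there before. At the end only
    the descent before it is possible. *)
Lemma descents_insert (x y : int) (s : seq int) i (b : bool) :
  (forall z, z \in x :: s -> (`|z| < `|y|)%N) -> (y < 0) = b -> (i <= size s)%N ->
  descents x (take i s ++ y :: drop i s) =
  if (i < size s)%N then
    (descents x s + ~~ (nth x s i < nth x (x :: s) i)%R)%N
  else (descents x s + b)%N.
Proof.
move=> big yb; have lt_y z : z \in x :: s -> ((z < y) = ~~ b) * ((y < z) = b).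
  by move=> /big; rewrite -yb; case: (ltP y 0) => ? ?; split; lia.
case: ltnP => [si _|si i_le].
  rewrite -{3}(cat_take_drop i s) !descents_cat -addnA; congr (_ + _)%N.
  rewrite (drop_nth x si) /=.
  have L : last x (take i s) = nth x (x :: s) i.
    by rewrite (last_nth x) size_take si -[x :: take i s]/(take i.+1 (x :: s)) nth_take.
  have m1 : nth x (x :: s) i \in x :: s by rewrite mem_nth//=; lia.
  have m2 : nth x s i \in x :: s by rewrite in_cons mem_nth ?orbT.
  rewrite L (lt_y _ m1).2 (lt_y _ m2).1.
  by case: b {big yb lt_y}; case: (_ < _); lia.
have -> : i = size s by lia.
rewrite take_size drop_size descents_cat /= addn0.
by rewrite (lt_y _ (mem_last x s)).2.
Qed.

Lemma sum_descents (x : int) (s : seq int) :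
  (\sum_(i < size s) (nth x s i < nth x (x :: s) i)%R)%N = descents x s.
Proof.
elim: s x => [|y s IH] x; first by rewrite big_ord0.
rewrite /= big_ord_recl /= -(IH y); congr (_ + _)%N.
apply: eq_bigr => -[i ilt] _ /=; rewrite !add0n.
have -> : nth x s i = nth y s i by apply: set_nth_default.
case: i ilt => [|i] ilt //=; congr nat_of_bool; congr (_ < _).
by apply: set_nth_default; exact: ltnW.
Qed.

End Descents.

Section Insertion.
Variable n : nat.

(* [(u, J)] encodes the signed permutation [u^J]. *)
Definition sgpair m := ('S_m * {set 'I_m})%type.

Definition sgval_pair m (p : sgpair m) (j : 'I_m) : int :=
  if j \in p.2 then - (p.1 j).+1%:Z else (p.1 j).+1%:Z.

Definition word m (p : sgpair m) : seq int := [seq sgval_pair p j | j <- enum 'I_m].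

(** [ord_max] stands for the new letter [n.+1], placed at position [i] and negated when [b] holds;
    [lift i] renumbers the old positions. *)
Definition insert (a : sgpair n * ('I_n.+1 * bool)) : sgpair n.+1 :=
  let: ((u, J), (i, b)) := a in
  (lift_perm i ord_max u, [set lift i j | j in J] :|: [set j | b && (j == i)]).

Lemma mem_insert_lift u J (i : 'I_n.+1) b (k : 'I_n) :
  (lift i k \in (insert ((u, J), (i, b))).2) = (k \in J).
Proof.
rewrite !inE (mem_imset _ _ (@lift_inj _ i)).
by rewrite eq_sym (negbTE (neq_lift i k)) andbF orbF.
Qed.

Lemma mem_insert_pos u J (i : 'I_n.+1) b : (i \in (insert ((u, J), (i, b))).2) = b.
Proof.
rewrite !inE eqxx andbT; case: imsetP => // -[k _ /eqP].
by rewrite (negbTE (neq_lift i k)).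
Qed.

Lemma insert_inj : injective insert.
Proof.
move=> [[u J] [i b]] [[v K] [j c]] E.
have E1 := congr1 fst E; rewrite /= in E1.
have ij : i = j.
  apply: (@perm_inj _ (lift_perm i ord_max u)).
  by rewrite {2}E1 !lift_perm_id.
subst j; have -> : u = v.
  apply/permP => k; apply: (@lift_inj _ (@ord_max n)).
  by rewrite -(lift_perm_lift i ord_max u) -(lift_perm_lift i ord_max v) E1.
have -> : J = K.
  by apply/setP => k; rewrite -(mem_insert_lift u J i b) E mem_insert_lift.
by congr (_, (_, _)); rewrite -(mem_insert_pos u J i b) E mem_insert_pos.
Qed.

Lemma card_sgpair m : #|{: sgpair m}| = (2 ^ m * m`!)%N.
Proof.
rewrite card_prod card_Sn -cardsT -powersetT card_powerset cardsT card_ord.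
by rewrite mulnC.
Qed.

(** Injectivity suffices, since [2^n n! * 2(n+1) = 2^(n+1) (n+1)!]. *)
Lemma insert_bij : bijective insert.
Proof.
apply: inj_card_bij insert_inj _.
rewrite card_sgpair [leqRHS]card_prod card_sgpair card_prod card_ord card_bool.
rewrite factS expnS.
by rewrite -!mulnA leq_eqVlt; apply/orP; left; apply/eqP; nia.
Qed.

(** Compared on underlying numbers: [lift i] fixes those below [i] and shifts the others by one. *)
Lemma enum_ord_insert (i : 'I_n.+1) :
  enum 'I_n.+1 = [seq lift i k | k <- take i (enum 'I_n)] ++
                 i :: [seq lift i k | k <- drop i (enum 'I_n)].
Proof.
have iN : (i <= n)%N by rewrite -ltnS.
have H : iota 0 n.+1 = iota 0 i ++ iota (0 + i) (n - i).+1.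
  by rewrite -iotaD; congr iota; lia.
apply: (inj_map val_inj); rewrite val_enum_ord H map_cat /= -!map_comp.
have E (s : seq 'I_n) : [seq (val \o lift i) k | k <- s] =
    [seq bump i k | k <- map val s] by rewrite -map_comp.
rewrite !E map_take map_drop val_enum_ord take_iota drop_iota.
rewrite (minn_idPl iN) add0n /=.
congr (_ ++ _ :: _).
  rewrite -[LHS]map_id; apply/eq_in_map => k; rewrite mem_iota => /andP[_ ki].
  by rewrite /bump leqNgt ki.
rewrite -add1n iotaDl; apply/eq_in_map => k; rewrite mem_iota.
by rewrite /bump => /andP[-> _].
Qed.

Lemma word_insert u J (i : 'I_n.+1) b :
  word (insert ((u, J), (i, b))) =
  take i (word (u, J)) ++ (if b then - n.+1%:Z else n.+1%:Z) :: drop i (word (u, J)).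
Proof.
rewrite /word (enum_ord_insert i) map_cat map_cons -map_take -map_drop.
have E k : sgval_pair (insert ((u, J), (i, b))) (lift i k) = sgval_pair (u, J) k.
  rewrite /sgval_pair mem_insert_lift /= lift_perm_lift.
  by rewrite /= /bump leqNgt ltn_ord.
congr (_ ++ _ :: _); [rewrite -map_comp; exact: eq_map| |
  rewrite -map_comp; exact: eq_map].
by rewrite /sgval_pair mem_insert_pos /= lift_perm_id.
Qed.

Lemma size_word m (p : sgpair m) : size (word p) = m.
Proof. by rewrite size_map size_enum_ord. Qed.

Lemma word_bound m (p : sgpair m) z : z \in 0 :: word p -> (`|z| < m.+1)%N.
Proof.
rewrite in_cons => /orP[/eqP->//|/mapP[j _ ->]].
by rewrite /sgval_pair; have := ltn_ord (p.1 j); case: ifP => _; lia.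
Qed.

Definition des_pair m (p : sgpair m) : nat := descents 0 (word p).

Lemma des_pair_insert p (i : 'I_n.+1) b :
  des_pair (insert (p, (i, b))) =
  if (i < n)%N then
    (des_pair p + ~~ (nth 0%R (word p) i < nth 0%R (0%R :: word p) i)%R)%N
  else (des_pair p + b)%N.
Proof.
case: p => u J; rewrite /des_pair word_insert (@descents_insert _ _ _ _ b).
- by rewrite size_word.
- by move=> z /word_bound; case: b; lia.
- by case: b; lia.
- by rewrite size_word -ltnS.
Qed.

Definition sgn_pair (R : realType) m (p : sgpair m) : R :=
  (-1) ^+ #|p.2| * (-1) ^+ (p.1 : bool).

Lemma sgn_pair_insert (R : realType) p (i : 'I_n.+1) b :
  sgn_pair R (insert (p, (i, b))) = sgn_pair R p * (-1) ^+ b * (-1) ^+ (odd i (+) odd n).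
Proof.
case: p => u J; rewrite /sgn_pair /= odd_lift_perm.
have -> : #|[set lift i j | j in J] :|: [set j | b && (j == i)]| = (#|J| + b)%N.
  rewrite cardsU (_ : _ :&: _ = finset.set0) ?cards0 ?subn0.
    rewrite card_imset; last exact: lift_inj.
    congr (_ + _)%N; case: b => /=; last first.
      by rewrite (_ : [set _ | _] = finset.set0) ?cards0//; apply/setP => j; rewrite !inE.
    by rewrite (_ : [set _ | _] = [set i]) ?cards1//; apply/setP => j; rewrite !inE.
  apply/setP => j; rewrite !inE; apply/negP => /andP[/imsetP[k _ ->]].
  by rewrite eq_sym (negbTE (neq_lift i k)) andbF.
rewrite exprD !signr_addb.
have E (x y z t v : R) : x * y * (z * t * v) = x * v * y * (z * t) by ring.
exact: E.
Qed.

End Insertion.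

Arguments insert {n} : simpl never.

(** * Plain and signed sums over signed permutations, by insertion *)

Section SignedSums.
Context {R : realType}.
Implicit Types (h : nat -> R) (n k : nat).

Lemma sum_insert n (F : sgpair n.+1 -> R) :
  \sum_p F p = \sum_p \sum_(i < n.+1) \sum_b F (insert (p, (i, b))).
Proof.
rewrite (reindex _ (onW_bij _ (@insert_bij n))) /=.
under [RHS]eq_bigr do rewrite pair_bigA.
by rewrite pair_bigA; apply: eq_bigr => -[p [i b]] _.
Qed.

Lemma sum_des_pair n h :
  \sum_(p : sgpair n) h (des_pair p) = (2 ^ n * n`!)%:R * eulerB_mean n h.
Proof.
elim: n h => [|n IH] h.
  rewrite mul1r /= (eq_bigr (fun=> h 0%N)) => [|p _].
    by rewrite sumr_const card_sgpair.
  by rewrite /des_pair /word (size0nil (size_enum_ord 0)).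
rewrite sum_insert.
transitivity ((n.+1.*2)%:R * \sum_(p : sgpair n) eulerB_step n h (des_pair p)).
  rewrite mulr_sumr; apply: eq_bigr => p _.
  rewrite big_ord_recr /= !big_bool /= !des_pair_insert ltnn addn1 addn0.
  set k := des_pair p.
  (* At an inner position both signs agree, and [k] is kept exactly when a descent was already
     there. So [2k] inner insertions keep [k], and the positive letter at the end is one more. *)
  have E i : \sum_(b : bool) h (des_pair (insert (p, (widen_ord (leqnSn n) i, b)))) =
    2 * h k.+1 + (2 * (h k - h k.+1)) *
      (nth 0%R (word p) i < nth 0%R (0%R :: word p) i)%R%:R.
    rewrite big_bool /= !des_pair_insert /= ltn_ord -/k.
    by case: (_ < _); rewrite /= ?addn0 ?addn1 ?mulr1 ?mulr0; ring.
  under eq_bigr do rewrite E.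
  rewrite big_split /= sumr_const card_ord -mulr_sumr -natr_sum.
  have -> : (\sum_(i < n) (nth 0%R (word p) i < nth 0%R (0%R :: word p) i)%R)%N = k.
    by rewrite /k /des_pair -sum_descents size_word.
  rewrite /eulerB_step [RHS]mulrC divfK ?pnatr_eq0//.
  rewrite -(natr1 k.*2) -(natr1 n.*2) -!muln2 !natrM -[_ *+ n]mulr_natr.
  by ring.
by rewrite IH /= mulrA -natrM; congr (_%:R * _); rewrite factS expnS -!muln2; nia.
Qed.

(** This is the sum of [(-1)^k binom(n, k) h k] over [k <= n]. *)
Fixpoint alt_diff n h : R :=
  if n is m.+1 then alt_diff m (fun k => h k - h k.+1) else h 0%N.

(* Inserting [n.+1] and [- n.+1] anywhere but at the end yields the same number
   of descents with opposite signs. *)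
Lemma sum_sgn_des_pair n h :
  \sum_(p : sgpair n) sgn_pair R p * h (des_pair p) = alt_diff n h.
Proof.
elim: n h => [|n IH] h.
  rewrite /= (eq_bigr (fun=> h 0%N)) => [|p _].
    by rewrite sumr_const card_sgpair.
  rewrite /des_pair /word (size0nil (size_enum_ord 0)) /= /sgn_pair.
  have -> : p.2 = finset.set0 by apply/setP => -[].
  have -> : p.1 = 1%g by apply/permP => -[].
  by rewrite cards0 odd_perm1 !mul1r.
rewrite sum_insert /= -IH; apply: eq_bigr => p _.
rewrite big_ord_recr /= big1 => [|i _].
  (* At the last position the permutation sign is unchanged: the positive letter gives [h k] and the
     negative one [- h k.+1]. *)
  rewrite add0r big_bool /= !des_pair_insert !sgn_pair_insert /= ltnn addbb.
  by rewrite addn0 addn1; ring.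
rewrite big_bool /= !des_pair_insert !sgn_pair_insert /= ltn_ord.
by ring.
Qed.

End SignedSums.

(** * Identification of the group of signed permutations with pairs *)

Section SignedPermPairs.
Variable n : nat.
Implicit Types (p : sgpair n) (w : signed_perm n).

Definition sp_pair w : sgpair n := (sp_abs w, sp_neg w).

Lemma sgval_sp_pair w j : sgval_pair (sp_pair w) j = sp_val w j.+1.
Proof. by rewrite sp_decomposition. Qed.

Lemma zval_bound (i : 'I_n.*2.+1) : (`|zval i| <= n)%N.
Proof. by rewrite /zval; have := ltn_ord i; lia. Qed.

(** The pair determines the values at nonnegative arguments, and oddness gives the others. *)
Lemma sp_pair_inj : injective sp_pair.
Proof.
move=> v w E; have V k : (k <= n)%N -> sp_val v k = sp_val w k.
  case: k => [|k] kn; first by rewrite !sp_val0.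
  by rewrite -[k]/(val (Ordinal kn)) -!sgval_sp_pair E.
have nonneg i : 0 <= zval i -> sgval v i = sgval w i.
  move=> i0; have := V _ (zval_bound i); rewrite /sp_val.
  suff -> : inord (n + `|zval i|) = i by move/zval_inj.
  by apply/zval_inj; rewrite zval_inord ?zval_bound//; lia.
apply/val_inj/permP => i; have [/nonneg//|i0] := leP 0 (zval i).
apply/zval_inj/oppr_inj; rewrite -!sp_valN nonneg// zval_rev_ord.
by lia.
Qed.

(** The word preceded by [w(0) = 0], as a total function; past [n] it takes the default 0. *)
Definition signed_letter p (k : nat) : int :=
  if k is k'.+1 then oapp (sgval_pair p) 0 (insub k') else 0.

Lemma signed_letterS p (j : 'I_n) : signed_letter p j.+1 = sgval_pair p j.
Proof. by rewrite /signed_letter valK. Qed.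

Lemma abs_sgval_pair p j : `|sgval_pair p j|%N = (p.1 j).+1.
Proof. by rewrite /sgval_pair; case: ifP; lia. Qed.

Lemma signed_letter_bound p k : (k <= n)%N ->
  (`|signed_letter p k| <= n)%N /\ (`|signed_letter p k|%N == 0%N) = (k == 0%N).
Proof.
case: k => [//|k] kn; rewrite (signed_letterS p (Ordinal kn)) abs_sgval_pair.
by split => //; exact: ltn_ord.
Qed.

Lemma signed_letter_abs_inj p k l : (k <= n)%N -> (l <= n)%N ->
  `|signed_letter p k|%N = `|signed_letter p l|%N -> k = l.
Proof.
case: k l => [|k] [|l] // kn ln E.
- by have [_] := signed_letter_bound p ln; rewrite -E.
- by have [_] := signed_letter_bound p kn; rewrite E.
move: E; rewrite (signed_letterS p (Ordinal kn)) (signed_letterS p (Ordinal ln)).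
by rewrite !abs_sgval_pair => -[/val_inj/perm_inj[->]].
Qed.

(** The odd extension of the word to [{-n, ..., n}]. The sum under the absolute value is already
    between 0 and [2n], so [absz] and [inord] only change its type. *)
Definition extend_pair p (i : 'I_n.*2.+1) : 'I_n.*2.+1 :=
  inord `|sgz (zval i) * signed_letter p `|zval i| + n%:Z|.

Lemma zval_extend_pair p i :
  zval (extend_pair p i) = sgz (zval i) * signed_letter p `|zval i|.
Proof.
have [b _] := signed_letter_bound p (zval_bound i).
have bz : (`|(sgz (zval i) * signed_letter p `|zval i|)%R| <= n)%N.
  by move: b; set L := signed_letter _ _; case: sgzP => _; lia.
rewrite /extend_pair; move: (sgz _ * _) bz => z bz.
by rewrite /zval inordK; lia.
Qed.

Lemma extend_pair_inj p : injective (extend_pair p).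
Proof.
move=> i j /(congr1 (@zval n)); rewrite !zval_extend_pair => E.
have [_ bi] := signed_letter_bound p (zval_bound i).
have [_ bj] := signed_letter_bound p (zval_bound j).
have abs0 (k : 'I_n.*2.+1) : `|(sgz (zval k) * signed_letter p `|zval k|)%R|%N =
    absz (signed_letter p (absz (zval k))).
  by case: sgzP => [->|_|_] /=; lia.
(* The absolute value of the letter gives that of the argument; the sign follows since only the
   argument 0 has letter 0. *)
have ij : `|zval i|%N = `|zval j|%N.
  apply: (@signed_letter_abs_inj p); rewrite ?zval_bound//.
  by rewrite -abs0 E abs0.
rewrite -ij in E bj; apply/zval_inj; move: E bi ij.
by set L := signed_letter _ _; do 2!case: sgzP; lia.
Qed.

Lemma extend_pair_sym p : perm (@extend_pair_inj p) \in B_group n.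
Proof.
rewrite inE; apply/forallP => i; rewrite !permE; apply/eqP/zval_inj.
rewrite zval_rev_ord !zval_extend_pair zval_rev_ord sgzN mulNr.
by rewrite abszN.
Qed.

Definition pair_sp p : signed_perm n := subg (B_group n) (perm (@extend_pair_inj p)).

Lemma sp_val_pair_sp p (j : 'I_n) : sp_val (pair_sp p) j.+1 = sgval_pair p j.
Proof.
rewrite /sp_val /pair_sp subgK ?extend_pair_sym// permE zval_extend_pair.
by rewrite zval_inord// -signed_letterS mul1r.
Qed.

Lemma pair_spK : cancel pair_sp sp_pair.
Proof.
move=> [u J]; congr (_, _).
  apply/permP => j; apply/val_inj; rewrite permE /= sp_val_pair_sp.
  by rewrite abs_sgval_pair.
apply/setP => j; rewrite inE sp_val_pair_sp /sgval_pair /=.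
by case: ifP; lia.
Qed.

Lemma sp_pair_bij : bijective sp_pair.
Proof.
exists pair_sp; last exact: pair_spK.
by move=> w; apply: sp_pair_inj; rewrite pair_spK.
Qed.

Lemma desB_pair w : desB w = des_pair (sp_pair w).
Proof.
rewrite /desB card_descents sp_val0 /des_pair /word -val_enum_ord -map_comp.
by congr descents; apply: eq_map => j; rewrite sgval_sp_pair.
Qed.

Lemma sgnB_pair (R : realType) w : (sgnB w)%:~R = sgn_pair R (sp_pair w).
Proof. by rewrite /sgnB rmorphM /= !rmorphXn /= rmorphN1. Qed.

End SignedPermPairs.

(** * Means over one sign class *)

Section SignedMeans.
Context {R : realType}.
Implicit Types (f g h : nat -> R) (a b c : R) (n k : nat) (s : bool).

Lemma sgnB_bool n (w : signed_perm n) : exists b : bool, sgnB w = (-1) ^+ b.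
Proof.
exists (odd #|sp_neg w| (+) (sp_abs w : bool)).
by rewrite signr_addb signr_odd.
Qed.

(** Splits a sum over one sign class into half the plain sum plus or minus half the signed sum. *)
Lemma mem_B_sgn n s (w : signed_perm n) :
  (w \in B_sgn n s)%:R = (1 + (-1) ^+ s * (sgnB w)%:~R) / 2 :> R.
Proof.
rewrite inE; have [b ->] := sgnB_bool w.
by case: s; case: b; rewrite /= ?expr1 ?expr0 ?rmorphN ?rmorph1 //=; field.
Qed.

Lemma sum_B_sgn n s h :
  \sum_(w in B_sgn n s) h (desB w) =
  ((2 ^ n * n`!)%:R * eulerB_mean n h + (-1) ^+ s * alt_diff n h) / 2.
Proof.
rewrite big_mkcond /= -sum_des_pair -sum_sgn_des_pair.
rewrite !(reindex _ (onW_bij _ (@sp_pair_bij n))) /= mulr_sumr -big_split /= mulr_suml.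
apply: eq_bigr => w _; rewrite -sgnB_pair -desB_pair.
have E (x y z : R) : (x + y * (z * x)) / 2 = (1 + y * z) / 2 * x by field.
by rewrite E -mem_B_sgn; case: ifP => _; rewrite ?mul1r ?mul0r.
Qed.

(** Each difference at most doubles the supremum. *)
Lemma alt_diff_bound n h c : (forall k, `|h k| <= c) -> `|alt_diff n h| <= 2 ^+ n * c.
Proof.
elim: n h c => [|n IH] h c hc /=; first by rewrite mul1r.
rewrite exprSr -mulrA; apply: IH => k.
apply: le_trans (ler_normB _ _) _.
by have := hc k; have := hc k.+1; lra.
Qed.

Lemma eq_alt_diff n f g : f =1 g -> alt_diff n f = alt_diff n g.
Proof. by move=> /funext ->. Qed.

Lemma alt_diff0 n : alt_diff n (fun=> 0) = 0 :> R.
Proof.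
elim: n => //= n IH; rewrite -[RHS]IH; apply: eq_alt_diff => k.
by rewrite subrr.
Qed.

Lemma alt_diff_cst n c : (0 < n)%N -> alt_diff n (fun=> c) = 0.
Proof.
case: n => //= n _; rewrite -[RHS](alt_diff0 n); apply: eq_alt_diff => k.
by rewrite subrr.
Qed.

(** Each difference lowers the degree by one. Degrees one and two give the thresholds [2 <= n] for
    the mean and [3 <= n] for the variance. *)
Lemma alt_diff_affine n a b : (1 < n)%N -> alt_diff n (fun k => a * k%:R + b) = 0.
Proof.
case: n => //= n n1; rewrite -[RHS](@alt_diff_cst n (- a))//; apply: eq_alt_diff => k.
by rewrite -natr1; ring.
Qed.

Lemma alt_diff_sqr n a : (2 < n)%N -> alt_diff n (fun k => (k%:R - a) ^+ 2) = 0.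
Proof.
case: n => //= n n2; rewrite -[RHS](@alt_diff_affine n (- 2) (2 * a - 1))//.
by apply: eq_alt_diff => k; rewrite -natr1; ring.
Qed.

Lemma card_B_sgn n s : (0 < n)%N -> #|B_sgn n s|%:R = (2 ^ n * n`!)%:R / 2 :> R.
Proof.
move=> n0; have := sum_B_sgn n s (fun=> 1).
by rewrite sumr_const eulerB_mean_cst alt_diff_cst// mulr0 addr0 mulr1.
Qed.

Lemma desB_le n (w : signed_perm n) : (desB w <= n)%N.
Proof. by rewrite /desB -[leqRHS]card_ord max_card. Qed.

Lemma sum_eulerianB_sgn n s h :
  \sum_(k < n.+1) h k * (eulerianB_sgn n k s)%:R = \sum_(w in B_sgn n s) h (desB w).
Proof.
rewrite (partition_big (fun w => inord (desB w) : 'I_n.+1) xpredT)//=.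
apply: eq_bigr => k _; rewrite /eulerianB_sgn.
rewrite (eq_bigr (fun=> h k)) => [|w /andP[_ /eqP <-]]; last first.
  by rewrite inordK// ltnS desB_le.
rewrite sumr_const mulr_natr; congr (_ *+ _); apply: eq_card => w.
rewrite !inE; congr (_ && _); first by rewrite inE.
by rewrite -val_eqE /= inordK// ltnS desB_le.
Qed.

Lemma mean_eulerianB_sgn n s h : (0 < n)%N ->
  \sum_(k < n.+1) h k * ((eulerianB_sgn n k s)%:R / #|B_sgn n s|%:R) =
  eulerB_mean n h + (-1) ^+ s * alt_diff n h / (2 ^ n * n`!)%:R.
Proof.
move=> n0; under eq_bigr do rewrite mulrA.
rewrite -mulr_suml sum_eulerianB_sgn sum_B_sgn card_B_sgn//.
have N0 : (2 ^ n * n`!)%:R != 0 :> R.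
  by rewrite pnatr_eq0 muln_eq0 expn_eq0 -lt0n fact_gt0.
by move: (_%:R) N0 => N N0; field.
Qed.

End SignedMeans.

(** * Random variables *)

Section LatticeDistribution.
Local Open Scope classical_set_scope.
Local Open Scope ring_scope.
Context d (T : measurableType d) {R : realType} (P : probability T R).

(** The level sets of [0, ..., n] carry total mass 1, so their complement is null and the integral
    splits into constants on disjoint sets. *)
Lemma expectation_pmf_nat (X : {RV P >-> R}) n (f : R -> R) :
  measurable_fun setT f -> \sum_(k < n.+1) pmf X k%:R = 1 ->
  'E_P[f \o X]%E = (\sum_(k < n.+1) f k%:R * pmf X k%:R)%:E.
Proof.
move=> mf X1; pose A (k : 'I_n.+1) : set T := X @^-1` [set k%:R].
have mA k : measurable (A k).
  by rewrite -[A k]setTI; apply: (measurable_funPT X) => //; exact: measurable_set1.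
have PA k : P (A k) = (pmf X k%:R)%:E by rewrite /pmf fineK// fin_num_measure.
have tA : trivIset setT A.
  move=> i j _ _ [t [/= ti tj]]; apply/val_inj/eqP.
  by rewrite -(eqr_nat R) -ti -tj.
pose D := \big[setU/set0]_(k < n.+1) A k.
have mD : measurable D by exact: bigsetU_measurable.
have PD : P (~` D) = 0%E.
  rewrite probability_setC// /D measure_bigsetU_ord//.
  by rewrite (eq_bigr _ (fun k _ => PA k)) sumEFin X1 subee.
have mfX : measurable_fun setT (EFin \o (f \o X)).
  exact/measurable_EFinP/measurableT_comp.
rewrite unlock -(setUv D) integral_setU//; last 3 first.
- exact: measurableC.
- by rewrite setUv.
- exact/disj_setPCl.
rewrite [X in (_ + X)%E]null_set_integral ?adde0//; last 2 first.
- exact: measurableC.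
- exact: measurable_funTS.
rewrite /D integral_bigsetU_EFin//; last 3 first.
- exact: index_enum_uniq.
- exact: sub_trivIset tA.
- exact: measurable_funTS.
rewrite -sumEFin; apply: eq_bigr => k _.
rewrite (eq_integral (cst (f k%:R)%:E)) => [|t /set_mem /= -> //].
by rewrite integral_cst// EFinM; congr (_ * _)%E; exact: PA.
Qed.

(** The [cdf] is the expectation of an indicator composed with [X]. *)
Lemma cdf_standardize_pmf_nat (X : {RV P >-> R}) n x :
  \sum_(k < n.+1) pmf X k%:R = 1 ->
  cdf (standardize X) x = (\sum_(k < n.+1)
    ((k%:R - fine 'E_P[X]) / Num.sqrt (fine 'V_P[X]) <= x)%R%:R * pmf X k%:R)%:E.
Proof.
move=> X1; set m := fine 'E_P[X]; set sd := Num.sqrt _.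
pose g (y : R) := (y - m) / sd.
have mg : measurable_fun setT g.
  by apply: measurable_funM => //; exact: measurable_funB.
pose S : set R := g @^-1` `]-oo, x].
have mS : measurable S by rewrite -[S]setTI; exact: mg.
have mI : measurable_fun setT (\1_S : R -> R) by exact: measurable_indic.
transitivity ('E_P[\1_(X @^-1` S)])%E.
  by rewrite expectation_indic// -[X @^-1` S]setTI; exact: (measurable_funPT X).
rewrite -[\1_(X @^-1` S)]/((\1_S : R -> R) \o X) (expectation_pmf_nat mI X1).
congr (_%:E); apply: eq_bigr => k _; congr (_ * _).
rewrite indicE; congr (nat_of_bool _)%:R.
by apply/idP/idP; rewrite inE /S /= in_itv.
Qed.

End LatticeDistribution.

(** * The limit law on a sign class *)

Section SignedCDF.
Local Open Scope classical_set_scope.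
Local Open Scope ring_scope.

Lemma cvg_signed_cdf {R : realType} (s : bool) (x : R)
    (h := fun n k => (centred n k / std_dev n <= x)%R%:R : R) :
  eulerB_mean n (h n) + (-1) ^+ s * alt_diff n (h n) / (2 ^ n * n`!)%:R
    @[n --> \oo] --> gauss_cdf x.
Proof.
rewrite -[X in _ --> X]addr0; apply: cvgD; first exact: cvg_eulerB_mean_cdf.
(* The signed term is at most [2^n / (2^n n!) = 1 / n!], and [n! >= n]. *)
apply/cvgr0Pnorm_le => e e0; near=> n.
have h1 k : `|h n k| <= 1 by rewrite /h ger0_norm// lern1 leq_b1.
have := alt_diff_bound n h1; rewrite mulr1 => B.
have N0 : 0 < (2 ^ n * n`!)%:R :> R by rewrite ltr0n muln_gt0 expn_gt0 fact_gt0.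
rewrite !normrM normr_sign mul1r normfV (gtr0_norm N0) ler_pdivrMr//.
apply: le_trans B _; rewrite natrM natrX mulrCA ler_peMr ?exprn_ge0//.
rewrite -ler_pdivrMl// mulr1.
apply: (@le_trans _ _ n%:R); first by near: n; exact: nbhs_infty_ger.
by rewrite ler_nat; exact: fact_geq.
Unshelve. all: by end_near. Qed.

End SignedCDF.

Unset Implicit Arguments.

Theorem theorem5p6 (R : realType) (s : bool)
    (d : nat -> measure_display) (T : forall n : nat, measurableType (d n))
    (P : forall n : nat, probability (T n) R)
    (W : forall n : nat, {RV (P n) >-> R})
    (W_pmf : forall n k : nat, (1 <= n)%N -> (k <= n)%N ->
       pmf (W n) k%:R = (eulerianB_sgn n k s)%:R / #|B_sgn n s|%:R) :
  [/\ asymptotically_normal W,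
      forall n : nat, (2 <= n)%N -> ('E_(P n)[W n] = (n%:R / 2)%:E)%E
    & forall n : nat, (3 <= n)%N -> ('V_(P n)[W n] = (n.+1%:R / 12)%:E)%E].
Proof.
have pmfE n (g : nat -> R) : (0 < n)%N -> \sum_(k < n.+1) g k * pmf (W n) k%:R =
    eulerB_mean n g + (-1) ^+ s * alt_diff n g / (2 ^ n * n`!)%:R.
  move=> n0; rewrite -mean_eulerianB_sgn//; apply: eq_bigr => k _.
  by rewrite W_pmf// -ltnS.
have pmf1 n : (0 < n)%N -> \sum_(k < n.+1) pmf (W n) k%:R = 1.
  move=> n0; transitivity (\sum_(k < n.+1) 1 * pmf (W n) k%:R).
    by apply: eq_bigr => k _; rewrite mul1r.
  rewrite (pmfE n (fun=> 1))// eulerB_mean_cst alt_diff_cst//.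
  by rewrite mulr0 mul0r addr0.
have meanW n (f : R -> R) : (0 < n)%N -> measurable_fun setT f ->
    'E_(P n)[f \o W n]%E = (eulerB_mean n (fun k => f k%:R) +
      (-1) ^+ s * alt_diff n (fun k => f k%:R) / (2 ^ n * n`!)%:R)%:E.
  move=> n0 mf; rewrite (expectation_pmf_nat mf (pmf1 n n0)).
  by rewrite (pmfE n (fun k => f k%:R)).
have EW n : (2 <= n)%N -> ('E_(P n)[W n] = (n%:R / 2)%:E)%E.
  move=> n2; rewrite -[W n : T n -> R]/(id \o W n) meanW ?(ltnW n2)//.
  rewrite (_ : alt_diff n _ = 0) ?mulr0 ?mul0r ?addr0; last first.
    rewrite -(@alt_diff_affine _ n 1 0)//; apply: eq_alt_diff => k.
    by rewrite mul1r addr0.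
  congr (_%:E); rewrite -[RHS]add0r -(eulerB_mean_centred n).
  rewrite -[n%:R / 2 in RHS](eulerB_mean_cst n) -eulerB_meanD.
  by apply: eq_eulerB_mean => k _; rewrite /centred subrK.
have VW n : (3 <= n)%N -> ('V_(P n)[W n] = (n.+1%:R / 12)%:E)%E.
  move=> n3; rewrite /variance unlock EW 1?ltnW//=.
  pose f (x : R) := (x - n%:R / 2) ^+ 2.
  have mf : measurable_fun setT f.
    by apply: measurable_funX; exact: measurable_funB.
  rewrite (_ : (_ * _)%R = f \o W n); last first.
    by apply/funext => t; rewrite /f /= expr2.
  rewrite meanW//; last by lia.
  by rewrite /f alt_diff_sqr// mulr0 mul0r addr0 eulerB_mean_sqr// ltnW.
split=> // x.
pose h n k : R := (centred n k / std_dev n <= x)%R%:R.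
(* From [n = 3] on, mean and variance are the exact values, so standardizing gives precisely
   [centred n k / std_dev n]; smaller [n] do not affect the limit. *)
have cdfE n : (3 <= n)%N -> cdf (standardize (W n)) x =
    (eulerB_mean n (h n) + (-1) ^+ s * alt_diff n (h n) / (2 ^ n * n`!)%:R)%:E.
  move=> n3; have n0 : (0 < n)%N by lia.
  rewrite (cdf_standardize_pmf_nat x (pmf1 n n0)) EW 1?ltnW// VW//=.
  by rewrite (pmfE n (h n)).
rewrite -gauss_cdf_EFin.
have cu := @cvg_signed_cdf R s x.
apply: cvg_EFin; first by near=> n; rewrite cdfE//; near: n; exact: nbhs_infty_ge.
apply: cvg_trans cu; apply: near_eq_cvg; near=> n.
by rewrite /= cdfE//; near: n; exact: nbhs_infty_ge.
Unshelve. all: by end_near. Qed.
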